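(* Let $r>1$ be an integer, and assume that the most reliable cubic graph with $2(r-1)$ vertices near zero does not maximize the number of spanning trees among graphs with the same number of vertices and edges. Then there exists $n_0$ such that for all $n>n_0$ no uniformly most reliable graph exists with $n$ vertices and redundancy $r$.
   Context: Graphs are finite undirected multigraphs. The redundancy of a graph with $n$ vertices and $m$ edges is $r=m-(n-1)$. If each edge of $G$ fails independently with probability $p$, $U_G(p)$ denotes the probability that $G$ becomes disconnected. A graph with $n$ vertices and $m$ edges is uniformly most reliable if it minimizes $U_G(p)$ among all graphs with $n$ vertices and $m$ edges, for every $p\in[0,1]$. A cubic graph is a most reliable cubic graph near zero if there is $p'>0$ such that it minimizes $U_G(p)$ among all cubic graphs with the same number of vertices, for all $p\in[0,p']$. (Any two such graphs on the same number of vertices have the same polynomial $U_G$, hence the same number of spanning trees.) A cubic graph with $2(r-1)$ vertices has $3(r-1)$ edges. *)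

(* Defs.v *)
From HB Require Import structures.
From mathcomp Require Import all_boot all_order all_algebra.
From mathcomp Require Import reals.

Set Implicit Arguments.
Unset Strict Implicit.
Unset Printing Implicit Defensive.

Import Order.TTheory GRing.Theory Num.Theory.

Local Open Scope ring_scope.

(* Parallel edges and loops are allowed.  The order of the two ends of an edge
   carries no meaning: every notion below is invariant under swapping them. *)
Record multigraph : Type := Multigraph {
  vertex : finType;
  edge : finType;
  ends : edge -> vertex * vertex
}.

Section Multigraph.
Variable G : multigraph.
Implicit Types (S C T F : {set edge G}) (x y v : vertex G) (e : edge G).

Definition nvertices : nat := #|vertex G|.
Definition nedges : nat := #|edge G|.

(* Integer-valued, so that the subtraction is not truncated. *)
Definition redundancy : int := nedges%:Z - (nvertices%:Z - 1).

Definition joins e x y : bool := (ends e == (x, y)) || (ends e == (y, x)).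

Definition adjacent S : rel (vertex G) :=
  [rel x y | [exists e in S, joins e x y]].

Definition connected S : bool :=
  [forall x, forall y, connect (adjacent S) x y].

(* A loop at v contributes 2. *)
Definition degree S v : nat :=
  (\sum_(e in S) (((ends e).1 == v) + ((ends e).2 == v)))%N.

Definition cubic : bool := [forall v, degree [set: edge G] v == 3].

(* C is the edge set of a connected 2-regular subgraph (a loop and a pair of
   parallel edges are cycles); the vertices of that subgraph are those of
   nonzero degree. *)
Definition is_cycle C : bool :=
  [&& C != set0,
      [forall v, degree C v \in [:: 0%N; 2]] &
      [forall x, forall y, (degree C x != 0%N) ==> (degree C y != 0%N) ==>
         connect (adjacent C) x y]].

Definition acyclic S : bool := [forall C : {set edge G}, (C \subset S) ==> ~~ is_cycle C].

Definition spanning_tree T : bool := connected T && acyclic T.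

Definition num_spanning_trees : nat := #|[set T | spanning_tree T]|.

(* Probability that F is exactly the set of failed edges. *)
Definition failure_prob (R : realType) (p : R) F : R :=
  \prod_(e : edge G) (if e \in F then p else 1 - p).

Definition unreliability (R : realType) (p : R) : R :=
  \sum_(F : {set edge G} | ~~ connected (~: F)) failure_prob p F.

End Multigraph.

Definition uniformly_most_reliable (R : realType) (G : multigraph) : Prop :=
  forall p : R, 0 <= p <= 1 ->
  forall H : multigraph, nvertices H = nvertices G -> nedges H = nedges G ->
  unreliability G p <= unreliability H p.

Definition most_reliable_cubic_near_zero (R : realType) (G : multigraph) : Prop :=
  cubic G /\
  exists2 p' : R, 0 < p' &
    forall p : R, 0 <= p <= p' ->
    forall H : multigraph, cubic H -> nvertices H = nvertices G ->
    unreliability G p <= unreliability H p.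

Definition maximizes_spanning_trees (G : multigraph) : Prop :=
  forall H : multigraph, nvertices H = nvertices G -> nedges H = nedges G ->
  (num_spanning_trees H <= num_spanning_trees G)%N.

(* Main.v *)
Require Import Defs.
From HB Require Import structures.
From mathcomp Require Import all_boot all_order all_algebra.
From mathcomp Require Import boolp reals lra zify.

Set Implicit Arguments.
Unset Strict Implicit.
Unset Printing Implicit Defensive.

Import Order.TTheory GRing.Theory Num.Theory.

Local Open Scope ring_scope.

(* Put y = p / (1 - p). For a graph with m edges, the probability of staying
   connected is (1 - p)^m P(y), where P(y) is the sum of y^|F| over the sets F of
   edges whose removal leaves the graph connected; its coefficient of degree r, the
   redundancy, is the number of spanning trees. Contracting bridges, and merging
   two edges that form a cut into one edge of added weight, turns any connected
   graph into a weighted 3-edge-connected graph D with the same redundancy and the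
   same polynomial; subdividing edges is the inverse operation.

   Let H be uniformly most reliable with m edges. Comparing the coefficients of
   degrees 1 and 2 of its polynomial with those of a balanced subdivision of a
   3-edge-connected cubic graph shows that, for m large, D is cubic on 2(r-1)
   vertices and all its weights are within a constant of q = m / (3(r-1)). Hence,
   after rescaling y by q, the polynomial of D dominates asymptotically those of
   all graphs with 2(r-1) vertices and 3(r-1) edges, in particular of G and of a
   graph K with more spanning trees than G. Only finitely many polynomials can
   occur for D, so one of them dominates both exactly. Being dominated by that of
   G near zero, it equals that of G, and at infinity it is beaten by that of K. *)

(** * Connectivity through two-colourings *)

Section Cuts.
Variable G : multigraph.
Implicit Types (S F C T : {set edge G}) (col : vertex G -> bool) (e f : edge G).

Definition cut col : {set edge G} := [set e | col (ends e).1 != col (ends e).2].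

Lemma notin_cut col e : (e \notin cut col) = (col (ends e).1 == col (ends e).2).
Proof. by rewrite inE negbK. Qed.

Lemma joins_ends e : joins e (ends e).1 (ends e).2.
Proof. by rewrite /joins -surjective_pairing eqxx. Qed.

Lemma adjacent_sym S : symmetric (adjacent S).
Proof.
by move=> x y; apply/exists_inP/exists_inP => -[e eS /orP[] h];
  exists e => //; rewrite /joins h ?orbT.
Qed.

Lemma connect_adjacent_sym S : connect_sym (adjacent S).
Proof. exact/sym_connect_sym/adjacent_sym. Qed.

(** A colouring constant along edges is constant along paths; conversely, reachability from a fixed
    vertex is such a colouring. *)
Lemma connectedP S :
  reflect (forall col, {in S, forall e, e \notin cut col} ->
             forall x y, col x = col y)
          (connected S).
Proof.
apply: (iffP forallP) => [conS col inv x y|conS x].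
  have /forallP/(_ y)/connectP[p + ->] := conS x.
  elim: p x => //= z p IHp x /andP[/exists_inP[e eS xz] /IHp <-].
  have := inv e eS; rewrite notin_cut => /eqP.
  by case/orP: xz => /eqP->.
apply/forallP => y; rewrite -(conS (connect (adjacent S) x) _ x y) => [|e eS].
  exact: connect0.
rewrite notin_cut; apply/eqP.
apply: (same_connect_r (connect_adjacent_sym S)); apply: connect1.
by apply/exists_inP; exists e => //; apply: joins_ends.
Qed.

Lemma connected_sub S T : S \subset T -> connected S -> connected T.
Proof.
move=> /subsetP sST /connectedP conS; apply/connectedP => col inv.
by apply: conS => e /sST /inv.
Qed.

Lemma connected_setC F :
  reflect (forall col, cut col \subset F -> forall x y, col x = col y)
          (connected (~: F)).
Proof.
apply: (iffP (connectedP _)) => h col inv; apply: h.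
  by move=> e; rewrite inE; apply: contra; apply: subsetP.
by apply/subsetP => e; apply: contraLR => eF; apply: inv; rewrite inE.
Qed.

Lemma disconnecting_cut F : ~~ connected (~: F) ->
  exists2 col, cut col \subset F & exists x y, col x != col y.
Proof.
rewrite /connected negb_forall => /existsP[x]; rewrite negb_forall => /existsP[y].
set g := connect _ => ngxy; exists (g x).
  apply/subsetP => e; apply: contraLR => eF; rewrite notin_cut; apply/eqP.
  apply: (same_connect_r (connect_adjacent_sym _)); apply: connect1.
  by apply/exists_inP; exists e; rewrite ?inE // joins_ends.
by exists x, y; rewrite (negPf ngxy) /g connect0.
Qed.

Lemma cut_addb col1 col2 :
  cut (fun x => col1 x (+) col2 x) = (cut col1 :\: cut col2) :|: (cut col2 :\: cut col1).
Proof.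
apply/setP => e; rewrite !inE.
by case: (col1 _); case: (col1 _); case: (col2 _); case: (col2 _).
Qed.

(** Adding [col] modulo 2 to a colouring whose cut contains [e] trades [e] for [f], so a cut inside
    [e |: F] becomes one inside [f |: F]. *)
Lemma cut_pair_exchange col e f F : cut col = [set e; f] -> f \notin F ->
  connected (~: (f |: F)) -> connected (~: (e |: F)).
Proof.
have [-> //|nef] := eqVneq e f.
move=> cutE fF /connected_setC con; apply/connected_setC => col1 sub1.
have [ecut|ecut] := boolP (e \in cut col1); last first.
  apply: con; apply: subset_trans (subsetUr _ _).
  apply/subsetP => e1 e1c; have := subsetP sub1 _ e1c; rewrite !inE => /orP[/eqP e1e|//].
  by rewrite -e1e e1c in ecut.
have {}con : forall x y, col x (+) col1 x = col y (+) col1 y.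
  apply: con; apply/subsetP => e1; rewrite cut_addb cutE.
  have := subsetP sub1 e1; rewrite in_setU1.
  rewrite !(in_setU, in_setD, in_set1).
  case: (eqVneq e1 e) => [->|_]; first by rewrite ecut.
  case: (eqVneq e1 f) => //= _.
  by move=> h; rewrite andbF.
(* The sum of the colourings is constant, yet [f] crosses [col] and not [col1]. *)
have : f \notin cut col1.
  by apply: contra fF => /(subsetP sub1); rewrite in_setU1 eq_sym (negPf nef).
have : f \in cut col by rewrite cutE !inE eqxx orbT.
rewrite notin_cut inE; have := con (ends f).1 (ends f).2.
by case: (col _); case: (col _); case: (col1 _); case: (col1 _).
Qed.

End Cuts.

(** * Contraction and subdivision *)

(* [D] arises from [D'] by contracting [f]. The last field says that no two
   vertices other than the ends of [f] are identified. *)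
Record contraction (D' D : multigraph) (f : edge D') := Contraction {
  cvertex : vertex D' -> vertex D;
  crepr : vertex D -> vertex D';
  cedge : edge D -> edge D';
  creprK : cancel crepr cvertex;
  cedge_inj : injective cedge;
  cedgeP : forall e, reflect (exists e1, cedge e1 = e) (e != f);
  cends : forall e, ends e = (cvertex (ends (cedge e)).1, cvertex (ends (cedge e)).2);
  cends_contracted : cvertex (ends f).1 = cvertex (ends f).2;
  crepr_cvertex : forall col : vertex D' -> bool,
    col (ends f).1 = col (ends f).2 -> forall x, col (crepr (cvertex x)) = col x
}.

Section Contraction.
Variables (D' D : multigraph) (f : edge D') (K : contraction D f).
Implicit Types (F : {set edge D}) (S : {set edge D'}).

Lemma cedge_neq e : cedge K e != f.
Proof. by apply/cedgeP; exists e. Qed.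

Lemma cedge_imset_notin F : f \notin cedge K @: F.
Proof. by apply/imsetP => -[e _ /esym/eqP]; apply/negP/cedge_neq. Qed.

Lemma mem_cedge_imset F e : (cedge K e \in cedge K @: F) = (e \in F).
Proof. exact/mem_imset/cedge_inj. Qed.

Lemma cedge_imset_preimset S : f \notin S -> cedge K @: (cedge K @^-1: S) = S.
Proof.
move=> fS; apply/setP => e; apply/imsetP/idP => [[e1 + ->]|eS]; first by rewrite inE.
have /(cedgeP K)[e1 e1E] : e != f by apply: contraNneq fS => <-.
by exists e1; rewrite ?inE e1E.
Qed.

Lemma cedge_preimset_imset F : cedge K @^-1: (cedge K @: F) = F.
Proof. by apply/setP => e; rewrite inE mem_cedge_imset. Qed.

Lemma cedge_preimset_imsetU1 F : cedge K @^-1: (f |: cedge K @: F) = F.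
Proof. by apply/setP => e; rewrite !inE mem_cedge_imset (negPf (cedge_neq e)). Qed.

(** Colourings of [D] pull back along [cvertex]; those of [D'] constant along [S] agree at the ends
    of [f], hence descend along [crepr]. *)
Lemma connected_contraction S : f \in S ->
  connected S = connected (cedge K @^-1: S).
Proof.
move=> fS; apply/connectedP/connectedP => con col inv x y.
  rewrite -(creprK K x) -(creprK K y).
  apply: (con (fun x => col (cvertex K x))) => e eS; rewrite notin_cut.
  have [->|/(cedgeP K)[e1 e1E]] := eqVneq e f; first by rewrite cends_contracted.
  have := inv e1; rewrite inE e1E => /(_ eS).
  by rewrite notin_cut (cends K) e1E.
have colf : col (ends f).1 = col (ends f).2.
  by apply/eqP; rewrite -notin_cut inv.
rewrite -(crepr_cvertex K colf x) -(crepr_cvertex K colf y).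
apply: (con (fun x => col (crepr K x))) => e; rewrite inE => eS.
by rewrite notin_cut (cends K) /= !(crepr_cvertex K colf) -notin_cut inv.
Qed.

Lemma connectedC_contraction F :
  connected (~: (cedge K @: F)) = connected (~: F).
Proof.
rewrite connected_contraction ?inE ?cedge_imset_notin //.
by congr connected; apply/setP => e; rewrite !inE mem_cedge_imset.
Qed.

Lemma nedges_contraction : nedges D' = (nedges D).+1.
Proof.
rewrite /nedges -(card_imset _ (@cedge_inj _ _ _ K)).
rewrite [LHS](cardD1 f) add1n; congr _.+1; apply: eq_card => e.
rewrite !inE andbT; apply/(cedgeP K)/imsetP => [[e1 <-]|[e1 _ ->]]; by exists e1.
Qed.

Lemma sum_contraction (V : nmodType) (phi : {set edge D'} -> V) :
  \sum_F phi F = \sum_(F : {set edge D}) phi (cedge K @: F) +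
                 \sum_(F : {set edge D}) phi (f |: cedge K @: F).
Proof.
rewrite (bigID (fun S => f \notin S)) /=; congr (_ + _).
  rewrite (reindex_onto (fun F => cedge K @: F) (fun S => cedge K @^-1: S)) /=.
    by apply: eq_bigl => F; rewrite cedge_imset_notin cedge_preimset_imset eqxx.
  by move=> F; apply: cedge_imset_preimset.
rewrite (reindex_onto (fun F => f |: cedge K @: F) (fun S => cedge K @^-1: S)) /=.
  by apply: eq_bigl => F; rewrite setU11 cedge_preimset_imsetU1 eqxx.
move=> F; rewrite negbK => fF; apply/setP => e; rewrite in_setU1.
have [->//|/(cedgeP K)[e1 <-]] := eqVneq e f.
by rewrite mem_cedge_imset inE.
Qed.

Lemma sum_cedge (V : nmodType) (c : edge D' -> V) :
  \sum_e c e = \sum_e c (cedge K e) + c f.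
Proof.
rewrite (bigD1 f) //= addrC; congr (_ + _).
transitivity (\sum_(e in cedge K @: predT) c e); last first.
  by rewrite big_imset //= => x y _ _; apply: cedge_inj.
by apply: eq_bigl => e; apply/(cedgeP K)/imsetP => [[e1 <-]|[e1 _ ->]]; exists e1.
Qed.

Lemma prod_cedge (A : comNzRingType) (c : edge D' -> A) F :
  \prod_(e in cedge K @: F) c e = \prod_(e in F) c (cedge K e).
Proof. by rewrite big_imset //= => x y _ _; apply: cedge_inj. Qed.

End Contraction.

(** With constant weight [p / (1 - p)] this is the probability of connectedness, up to a power of
    [1 - p]. *)
Definition wsum (G : multigraph) (A : comNzRingType) (c : edge G -> A) : A :=
  \sum_(F : {set edge G} | connected (~: F)) \prod_(e in F) c e.

Lemma wsum_bridge (A : comNzRingType) D' D (f : edge D') (K : contraction D f)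
    (c : edge D' -> A) :
  ~~ connected (~: [set f]) -> wsum c = wsum (fun e => c (cedge K e)).
Proof.
move=> ncon; rewrite /wsum big_mkcond (sum_contraction K) /= [X in _ + X]big1 ?addr0.
  rewrite [RHS]big_mkcond; apply: eq_bigr => F _.
  by rewrite connectedC_contraction prod_cedge.
move=> F _; rewrite ifN //; apply: contra ncon; apply: connected_sub.
by rewrite setCS sub1set setU11.
Qed.

Definition merge_weight (A : nmodType) D' D (f : edge D') (K : contraction D f)
  (e0 : edge D) (c : edge D' -> A) e : A := c (cedge K e) + c f *+ (e == e0).

Lemma sum_merge_weight (A : nmodType) D' D (f : edge D') (K : contraction D f) e0
    (c : edge D' -> A) : \sum_e merge_weight K e0 c e = \sum_e c e.
Proof.
rewrite big_split /= (sum_cedge K); congr (_ + _).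
by rewrite (bigD1 e0) //= eqxx mulr1n big1 ?addr0 // => e /negPf->.
Qed.

(** An admissible set contains at most one edge of the 2-cut, and exchanging the two preserves
    admissibility. So each set of [D] containing [e0] stands for two sets of [D'], whose weights add
    up. *)
Lemma wsum_merge (A : comNzRingType) D' D (f : edge D') (K : contraction D f)
    (e0 : edge D) (col : vertex D' -> bool) (c : edge D' -> A) :
  cut col = [set cedge K e0; f] -> wsum c = wsum (merge_weight K e0 c).
Proof.
move=> cutE; rewrite /wsum big_mkcond (sum_contraction K) /=.
have discon (F : {set edge D'}) : f \in F -> cedge K e0 \in F -> connected (~: F) = false.
  move=> fF eF; apply/negP => /connected_setC con.
  have : f \in cut col by rewrite cutE !inE eqxx orbT.
  rewrite inE (con col _ (ends f).1 (ends f).2) ?eqxx // cutE.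
  by apply/subsetP => e; rewrite !inE => /orP[]/eqP->.
transitivity (\sum_(F : {set edge D} | connected (~: F)) \prod_(e in F) c (cedge K e)
  + \sum_(F : {set edge D} | connected (~: F) && (e0 \in F))
      c f * \prod_(e in F :\ e0) c (cedge K e)).
  congr (_ + _).
    rewrite [RHS]big_mkcond; apply: eq_bigr => F _.
    by rewrite connectedC_contraction prod_cedge.
  rewrite (bigID (fun F : {set edge D} => e0 \in F)) /= big1 ?add0r; last first.
    by move=> F e0F; rewrite discon ?setU11 // inE mem_cedge_imset e0F orbT.
  rewrite [RHS](reindex_onto (fun F => e0 |: F) (fun F => F :\ e0)) /=; last first.
    by move=> F /andP[_ e0F]; rewrite setD1K.
  rewrite -big_mkcondr; apply: eq_big => F.
    rewrite setU11 andbT; have [e0F|e0F] := boolP (e0 \in F) => /=.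
      have [E|_] := eqVneq; last by rewrite andbF.
      by have := setD11 e0 (e0 |: F); rewrite E e0F.
    rewrite setU1K // eqxx andbT -(connectedC_contraction K) imsetU1.
    apply/idP/idP; first exact: (cut_pair_exchange cutE (cedge_imset_notin _ _)).
    apply: (@cut_pair_exchange _ col); first by rewrite cutE setUC.
    by rewrite mem_cedge_imset.
  move=> /andP[e0F _]; rewrite setU1K // big_setU1 ?cedge_imset_notin //=.
  by rewrite prod_cedge.
rewrite big_mkcondr -big_split; apply: eq_bigr => F _ /=.
have [e0F|e0F] := ifPn; last first.
  rewrite addr0; apply: eq_bigr => e eF; rewrite /merge_weight.
  by rewrite (negPf (memPn e0F _ eF)) addr0.
rewrite !(big_setD1 e0 e0F) /= -mulrDl /merge_weight eqxx mulr1n; congr (_ * _).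
by apply: eq_bigr => e; rewrite !inE => /andP[/negPf-> _]; rewrite addr0.
Qed.

Lemma contract_edge (G : multigraph) (f : edge G) : (ends f).1 != (ends f).2 ->
  exists D (K : contraction D f), nvertices G = (nvertices D).+1.
Proof.
set u := (ends f).1; set v := (ends f).2 => uv.
(* The end [v] is deleted and its edges are redirected to [u]. *)
pose V := {x : vertex G | x != v}; pose E := {e : edge G | e != f}.
pose u' : V := exist _ u uv.
pose pi x : V := insubd u' x.
have piv : pi v = u' by rewrite /pi /insubd insubF // eqxx.
have pival x : x != v -> val (pi x) = x by move=> xv; rewrite /pi /insubd insubT.
pose D := Multigraph (fun e : E => (pi (ends (val e)).1, pi (ends (val e)).2)).
exists D.
unshelve eexists.
  apply: (@Contraction G D f pi val val) => //.
  - by move=> x; apply/val_inj; rewrite pival ?(valP x).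
  - exact: val_inj.
  - move=> e; apply: (iffP idP) => [ef|[e1 <-]]; last exact: (valP e1).
    by exists (exist _ e ef).
  - by rewrite -/v piv; apply/val_inj; rewrite pival.
  - move=> col; rewrite -/u -/v => colE x.
    by have [->|xv] := eqVneq x v; rewrite ?piv ?pival.
rewrite /nvertices /= card_sig (cardD1 v) inE add1n; congr _.+1.
by apply: eq_card => x; rewrite !inE andbT.
Qed.

Section Subdivide.
Variables (G : multigraph) (e0 : edge G).

(** The vertex [None] is the midpoint; [Some e0] becomes the first half of the edge and [None] the
    second. *)
Definition subdivide : multigraph :=
  @Multigraph (option (vertex G)) (option (edge G)) (fun oe =>
    if oe is Some e then
      (Some (ends e).1, if e == e0 then None else Some (ends e).2)
    else (None, Some (ends e0).2)).

(** Transparent, so that its edge map computes to [Some]. *)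
Lemma subdivide_contraction : contraction (D' := subdivide) G None.
Proof.
apply: (@Contraction subdivide G None (odflt (ends e0).2) Some Some) => //=.
- by move=> e e1 [].
- by case=> [e|]; [left; exists e|right=> -[]].
- by move=> e; case: eqP => [<-|_]; case: (ends _).
- by move=> col colE [].
Defined.

Lemma cut_subdivide :
  cut (fun x : vertex subdivide => ~~ x) =
  [set cedge subdivide_contraction e0; None].
Proof.
apply/setP => -[e|]; rewrite !inE //= orbF.
by rewrite (inj_eq (@Some_inj _)); case: (e == e0).
Qed.

End Subdivide.

(** * Three-edge-connected graphs *)

Definition three_edge_connected (G : multigraph) :=
  forall F : {set edge G}, (#|F| <= 2)%N -> connected (~: F).

Lemma three_edge_connectedP (G : multigraph) :
  three_edge_connected G <->
  forall col : vertex G -> bool, (#|cut col| <= 2)%N -> forall x y, col x = col y.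
Proof.
split=> [tec col cut2|tec F F2].
  have /connected_setC con := tec _ cut2; exact: con.
apply/connected_setC => col sub; apply: tec.
exact: leq_trans (subset_leq_card sub) F2.
Qed.

Lemma eq_wsum (G : multigraph) (A : comNzRingType) (c d : edge G -> A) :
  c =1 d -> wsum c = wsum d.
Proof. by move=> cd; apply: eq_bigr => F _; apply: eq_bigr => e _. Qed.

(** Induction on the number of edges: contract a bridge, whose weight is lost, or merge a 2-cut,
    which keeps the total. Either way one vertex and one edge disappear, so the redundancy is
    unchanged. *)
Lemma reduce_to_three_edge_connected (G : multigraph) (c : edge G -> nat) :
  connected [set: edge G] -> (forall e, 0 < c e)%N ->
  exists D (d : edge D -> nat),
    [/\ three_edge_connected D,
        (nedges D + nvertices G = nedges G + nvertices D)%N,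
        (forall e, 0 < d e)%N,
        (\sum_e d e <= \sum_e c e)%N &
        forall (A : comNzRingType) (y : A),
          wsum (fun e => y *+ c e) = wsum (fun e => y *+ d e)].
Proof.
have [N] := ubnP (nedges G); elim: N => // N IHN in G c * => ltN con c0.
have con_contraction D (f : edge G) (K : contraction D f) : connected [set: edge D].
  by rewrite -[setT](_ : cedge K @^-1: setT = _) -?connected_contraction // preimsetT.
have [/forallP tec|] := boolP [forall F : {set edge G}, (#|F| <= 2)%N ==> connected (~: F)].
  by exists G, c; split=> // F; apply/implyP.
have [/existsP[f nconf] _|/existsPn nobridge] :=
  boolP [exists f : edge G, ~~ connected (~: [set f])].
  have [col sub [x [y xy]]] := disconnecting_cut nconf.
  have fcut : (ends f).1 != (ends f).2.
    apply: contra xy => /eqP fl; apply/eqP; apply: (connectedP _ con) => e _.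
    apply/negP => ecut; have := subsetP sub _ ecut; rewrite inE => /eqP ef.
    by move: ecut; rewrite ef inE fl eqxx.
  have [D [K Kn]] := contract_edge fcut.
  have [|||D1 [d [tec E d0 led W]]] := IHN D (fun e => c (cedge K e)).
  - by move: ltN; rewrite (nedges_contraction K).
  - exact: con_contraction K.
  - by move=> e; apply: c0.
  exists D1, d; split=> //.
  - by rewrite (nedges_contraction K) Kn addnS E addSn.
  - apply: leq_trans led _; rewrite (sum_cedge K c); exact: leq_addr.
  - by move=> A z; rewrite (wsum_bridge K).
rewrite negb_forall => /existsP[F]; rewrite negb_imply => /andP[F2 nconF].
have [col sub [x [y xy]]] := disconnecting_cut nconF.
have cut2 : #|cut col| == 2.
  rewrite eqn_leq (leq_trans (subset_leq_card sub) F2) ltnNge /=.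
  apply: contra xy => cut1; apply/eqP; move: cut1.
  rewrite leq_eqVlt => /orP[/cards1P[f cutE]|].
    have /negPn/connected_setC h := nobridge f; apply: h; by rewrite cutE.
  rewrite ltnS leqn0 cards_eq0 => /eqP cut0.
  by apply: (connectedP _ con) => e _; rewrite cut0 inE.
have /cards2P[e [f [ef cutE]]] := cut2.
have fcut : (ends f).1 != (ends f).2.
  have : f \in cut col by rewrite cutE !inE eqxx orbT.
  by rewrite inE; apply: contraNneq => ->.
have [D [K Kn]] := contract_edge fcut.
have /(cedgeP K)[e0 e0E] := ef; rewrite -e0E in cutE.
have [|||D1 [d [tec E d0 led W]]] := IHN D (merge_weight K e0 c).
- by move: ltN; rewrite (nedges_contraction K).
- exact: con_contraction K.
- by move=> e1; rewrite ltn_addr.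
exists D1, d; split=> //.
- by rewrite (nedges_contraction K) Kn addnS E addSn.
- by rewrite -(sum_merge_weight K e0 c).
- move=> A z; rewrite (wsum_merge _ cutE) -W; apply: eq_wsum => e1.
  rewrite /merge_weight mulrnDr; congr (_ + _).
  by case: (e1 == e0).
Qed.

(** While some weight exceeds 1, subdivide that edge and move one unit to the new half. The total
    weight stays fixed and the number of edges grows towards it. *)
Lemma exists_subdivision (X : multigraph) (b : edge X -> nat) :
  (forall e, 0 < b e)%N ->
  exists X' : multigraph,
    [/\ nedges X' = (\sum_e b e)%N,
        (nedges X' + nvertices X = nedges X + nvertices X')%N &
        forall (A : comNzRingType) (y : A),
          wsum (fun _ : edge X' => y) = wsum (fun e => y *+ b e)].
Proof.
have [N] := ubnP (\sum_e b e)%N.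
have [k] := ubnP (N - nedges X)%N.
elim: k => // k IHk in X b N * => ltk ltN b0.
have [/forallP b1|] := boolP [forall e, b e == 1].
  exists X; split=> //.
    by rewrite /nedges -sum1_card; apply: eq_bigr => e _; rewrite (eqP (b1 e)).
  by move=> A y; apply: eq_wsum => e; rewrite (eqP (b1 e)).
rewrite negb_forall => /existsP[e0 be0].
have b2 : (1 < b e0)%N by rewrite ltn_neqAle eq_sym be0 b0.
pose K := subdivide_contraction e0.
pose b' (e : edge (subdivide e0)) := if e is Some e1 then (b e1 - (e1 == e0))%N else 1%N.
have b'E : merge_weight K e0 b' =1 b.
  move=> e; rewrite /merge_weight /=; case: eqVneq => [->|_] /=.
    by rewrite mulr1n -[RHS](subnK (ltnW b2)).
  by rewrite subn0 addr0.
have sumb' : (\sum_e b' e = \sum_e b e)%N.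
  by rewrite -(sum_merge_weight K e0 b'); apply: eq_bigr => e _; rewrite b'E.
have ne : nedges (subdivide e0) = (nedges X).+1 by rewrite /nedges card_option.
have nv : nvertices (subdivide e0) = (nvertices X).+1 by rewrite /nvertices card_option.
have ltX : (nedges X < N)%N.
  apply: leq_ltn_trans ltN; rewrite /nedges -sum1_card.
  by apply: leq_sum => e _; apply: b0.
have [|||X' [E1 E2 W]] := IHk (subdivide e0) b' N.
- by rewrite ne subnS prednK ?subn_gt0.
- by rewrite sumb'.
- case=> [e|] //=; have [->|_] := eqVneq e e0; last by rewrite subn0.
  by rewrite subn_gt0.
exists X'; split; first by rewrite E1.
  by move: E2; rewrite ne nv addnS addSn => -[].
move=> A y; rewrite W (wsum_merge _ (cut_subdivide e0)); apply: eq_wsum => e.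
rewrite -b'E /merge_weight mulrnDr; congr (_ + _).
by case: (e == e0).
Qed.

Section JoinMidpoints.
Variables (M : multigraph) (e f : edge M).

(** For distinct [e] and [f], [inr false] and [inr true] are their midpoints, [inl e] and [inl f]
    the first halves, [inr ord0] and [inr ord_max] the second halves; the remaining [inr] edge joins
    the midpoints. *)
Definition join_midpoints : multigraph :=
  @Multigraph (vertex M + bool)%type (edge M + 'I_3)%type (fun h =>
    match h with
    | inl g => (inl (ends g).1,
        if g == e then inr false else if g == f then inr true else inl (ends g).2)
    | inr i => (inr (i != ord0),
        if i == ord0 then inl (ends e).2 else
        if i == ord_max then inl (ends f).2 else inr false)
    end).

(** A cut of at most two edges restricts to one of [M], so all old vertices have one colour; a
    midpoint of the other colour would force three cut edges. *)
Lemma join_midpoints_three_edge_connected :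
  e != f -> three_edge_connected M -> three_edge_connected join_midpoints.
Proof.
move=> ef /three_edge_connectedP tec; apply/three_edge_connectedP => col cut2.
pose i1 : 'I_3 := inord 1.
have colM : forall x y, col (inl x) = col (inl y).
  apply: (tec (fun x => col (inl x))); apply: leq_trans cut2.
  pose g (h : edge join_midpoints) : edge M := match h with
    inl h => h | inr i => if i == ord0 then e else f end.
  apply: leq_trans (leq_imset_card g _); apply/subset_leq_card/subsetP => h hcut.
  have [hh|] := boolP ((inl h : edge join_midpoints) \in cut col).
    by apply/imsetP; exists (inl h).
  move: hcut; rewrite notin_cut inE /=.
  have [->|_] := eqVneq h e.
    move=> he /eqP E; apply/imsetP; exists (inr ord0); rewrite /g ?eqxx // inE /= -E.
    exact: he.
  have [->|_] := eqVneq h f; last by move/negPf->.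
  move=> he /eqP E; apply/imsetP; exists (inr ord_max) => //; rewrite inE /= -E.
  exact: he.
have three (h1 h2 h3 : edge join_midpoints) : h1 != h2 -> h1 != h3 -> h2 != h3 ->
    ~~ [&& h1 \in cut col, h2 \in cut col & h3 \in cut col].
  move=> h12 h13 h23; have u : uniq [:: h1; h2; h3].
    by rewrite /= !inE negb_or h12 h13 h23.
  apply: contraTN cut2 => /and3P[c1 c2 c3]; rewrite -ltnNge.
  change (size [:: h1; h2; h3] <= #|cut col|)%N; rewrite -(card_uniqP u).
  by apply/subset_leq_card/subsetP => h; rewrite in_cons mem_seq2 => /or3P[]/eqP->.
pose a := col (inl (ends e).1).
have colE x : col (inl x) = a by apply: colM.
have fe : (f == e) = false by rewrite eq_sym (negPf ef).
have i10 : (i1 == ord0) = false by rewrite -val_eqE /= inordK.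
have i12 : (i1 == ord_max) = false by rewrite -val_eqE /= inordK.
have m0 : (ord_max == ord0 :> 'I_3) = false by [].
have lneq : (inl e : edge join_midpoints) != inl f by apply: contra ef => /eqP[->].
have rneq i j : i != j -> (inr i : edge join_midpoints) != inr j.
  by move=> ij; apply: contra ij => /eqP[->].
(* The stars of the midpoints prevent one midpoint from differing alone; three of the four halves
   prevent both from differing together. *)
have := three (inl e) (inr ord0) (inr i1) isT isT.
have := three (inl f) (inr ord_max) (inr i1) isT isT.
have := three (inl e) (inl f) (inr ord0) lneq isT isT.
move=> h1 /(_ (rneq _ _ _)) h2 /(_ (rneq _ _ _)) h3.
move: h1 h2 h3; rewrite ![ord0 == i1]eq_sym i10 ![ord_max == i1]eq_sym i12.
rewrite !inE /= !eqxx ?fe ?(negPf ef) ?i10 ?i12 ?m0 /= !colE.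
move=> h1 /(_ isT) h2 /(_ isT) h3 [x|[]] [y|[]]; rewrite ?colE //; move: h1 h2 h3; clear;
  case: (col (inr true)); case: (col (inr false)); by case: a.
Qed.

End JoinMidpoints.

(** Start from three parallel edges on two vertices; joining midpoints adds two vertices and three
    edges. *)
Lemma exists_three_edge_connected k : (0 < k)%N -> exists M : multigraph,
  [/\ nvertices M = (2 * k)%N, nedges M = (3 * k)%N & three_edge_connected M].
Proof.
case: k => // k _; elim: k => [|k [M [nv ne tec]]].
  exists (@Multigraph bool 'I_3 (fun _ => (false, true))).
  split; rewrite /nvertices /nedges /= ?card_bool ?card_ord //.
  apply/three_edge_connectedP => col; have [E|E] := eqVneq (col false) (col true).
    by move=> _ [] [].
  rewrite (_ : cut col = setT) ?cardsT ?card_ord //.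
  by apply/setP => e; rewrite !inE.
have /card_gt1P[e [f [_ _ ef]]] : (1 < #|edge M|)%N by rewrite [#|_|]ne mulnS.
exists (join_midpoints e f); split; last exact: join_midpoints_three_edge_connected.
- by rewrite /nvertices card_sum card_bool [#|_|]nv [RHS]mulnS addnC.
- by rewrite /nedges card_sum card_ord [#|_|]ne [RHS]mulnS addnC.
Qed.

(** * Spanning trees *)

Section SpanningTrees.
Variable G : multigraph.
Implicit Types (S F C T B Q : {set edge G}) (e f : edge G) (v x : vertex G).

Definition scut S (X : {set vertex G}) : {set edge G} := cut (fun x => x \in X) :&: S.

Lemma card_normalized v : #|powerset [set~ v]| = (2 ^ (nvertices G).-1)%N.
Proof. by rewrite card_powerset cardsC1. Qed.

(** There are 2^(n-1) vertex sets avoiding a fixed [v]. On them [scut S] is injective: two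
    colourings with equal cuts in [S] have a sum constant along [S]. *)
Lemma nvertices_le_connected S : connected S -> (nvertices G <= #|S|.+1)%N.
Proof.
move=> /connectedP con.
have [v _|V0] := pickP (vertex G); last by rewrite /nvertices (eq_card0 V0).
have n0 : (0 < nvertices G)%N by apply/card_gt0P; exists v.
rewrite -(prednK n0) ltnS.
rewrite -(leq_exp2l (m := 2)) // -(card_normalized v) -card_powerset.
rewrite -(card_in_imset (f := scut S)).
  apply/subset_leq_card/subsetP => _ /imsetP[X _ ->].
  by rewrite powersetE subsetIr.
move=> X Y; rewrite !powersetE => /subsetP vX /subsetP vY cutXY.
have nv (Z : {set vertex G}) : {subset Z <= [set~ v]} -> (v \in Z) = false.
  by move=> vZ; apply/negP => /vZ; rewrite !inE eqxx.
apply/setP => x; apply/eqP; rewrite -negb_add.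
rewrite -(con (fun x => (x \in X) (+) (x \in Y)) _ v x) ?nv // => e eS.
move/setP/(_ e): cutXY; rewrite !inE eS !andbT /= negbK.
by case: (_ \in X); case: (_ \in X); case: (_ \in Y); case: (_ \in Y).
Qed.

(** The dual count: if every edge of [S] is a bridge of [S], then [scut S] reaches every subset of
    [S] from the sets avoiding [v]. *)
Lemma minimally_connected_le_nvertices S :
  (0 < nvertices G)%N -> connected S -> {in S, forall e, ~~ connected (S :\ e)} ->
  (#|S|.+1 <= nvertices G)%N.
Proof.
move=> n0 /connectedP con bridges; have /card_gt0P[v _] := n0.
rewrite -(prednK n0) ltnS.
rewrite -(leq_exp2l (m := 2)) // -(card_normalized v) -card_powerset.
apply: leq_trans (leq_imset_card (scut S) _); apply/subset_leq_card/subsetP => B.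
rewrite powersetE => BS.
(* Each edge is, for some colouring, the only edge of [S] in the cut; these colourings are added
   modulo 2. *)
have [col colE] : exists col, cut col :&: S = B.
  have [N] := ubnP #|B|; elim: N B BS => // N IHN B BS ltN.
  have [->|[e eB]] := set_0Vmem B.
    exists (fun _ => true); apply/setP => e; by rewrite !inE eqxx.
  have [] := IHN (B :\ e); first exact: subset_trans (subD1set _ _) BS.
    by move: ltN; rewrite (cardsD1 e) eB.
  move=> col1 E1; have eS := subsetP BS e eB.
  have := bridges e eS; rewrite -[S :\ e]setCK => /disconnecting_cut[col2 sub2 [x [y xy]]].
  have e2 : e \in cut col2.
    apply: contraNT xy => ne2; apply/eqP; apply: con => f fS.
    have [->//|fe] := eqVneq f e; apply: contraL (fS) => /(subsetP sub2).
    by rewrite !inE negb_and fe.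
  have E2 : cut col2 :&: S = [set e].
    apply/setP => f; rewrite in_setI in_set1; have [->|fe] := eqVneq f e; first by rewrite e2.
    by apply/andP => -[/(subsetP sub2)]; rewrite !inE fe /= => /negPf->.
  exists (fun x => col1 x (+) col2 x); rewrite cut_addb; apply/setP => f.
  move/setP/(_ f): E1; move/setP/(_ f): E2; rewrite !in_setI in_setU !in_setD in_set1.
  have [->|fe] := eqVneq f e; first by rewrite eB e2 eS /= !andbT => _ ->.
  rewrite /=; case: (f \in S); rewrite ?andbF ?andbT //= => -> <-; by rewrite andbF orbF.
apply/imsetP; exists [set x | col x != col v].
  by rewrite powersetE; apply/subsetP => x; rewrite !inE; apply: contraNneq => ->.
rewrite -colE; congr (_ :&: _); apply/setP => e; rewrite !inE.
by case: (col (ends e).1); case: (col (ends e).2); case: (col v).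
Qed.

Lemma degree_setU1 e Q v : e \notin Q ->
  degree (e |: Q) v = (((ends e).1 == v) + ((ends e).2 == v) + degree Q v)%N.
Proof. by move=> eQ; rewrite /degree big_setU1. Qed.

Lemma sum_degree Q (col : pred (vertex G)) :
  (\sum_(v | col v) degree Q v = \sum_(e in Q) (col (ends e).1 + col (ends e).2))%N.
Proof.
rewrite exchange_big; apply: eq_bigr => e _; rewrite big_split /=.
have one x : (\sum_(v | col v) (x == v) = col x)%N.
  have [cx|ncx] := boolP (col x); last first.
    by apply: big1 => v cv; case: eqP => // xv; rewrite xv cv in ncx.
  rewrite (bigD1 x) //= eqxx big1 // => v /andP[_ /negPf].
  by rewrite eq_sym => ->.
by rewrite !one.
Qed.

(** The degree sum of [C] over one colour class is even, and the other edges of [C] contribute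
    evenly to it, so [e] is not cut either. *)
Lemma connected_rem_cycle C T e : is_cycle C -> C \subset T -> e \in C ->
  connected T -> connected (T :\ e).
Proof.
move=> /and3P[_ /forallP deg _] CT eC /connectedP con.
apply/connectedP => col inv; apply: con => f fT.
have [->|fe] := eqVneq f e; last by apply: inv; rewrite !inE fe.
have : ~~ odd (\sum_(v | col v) degree C v).
  elim/big_rec: _ => // v n _ /negPf; rewrite oddD => ->; rewrite addbF.
  by have := deg v; rewrite !inE => /orP[]/eqP->.
rewrite sum_degree (bigD1 e) //= oddD.
set s := (\sum_(i in _ | _) _)%N; have -> : odd s = false.
  rewrite /s; elim/big_rec: _ => // g n /andP[gC ge]; rewrite oddD => ->; rewrite addbF.
  have := inv g; rewrite !inE ge (subsetP CT) // => /(_ isT).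
  by rewrite negbK => /eqP->; rewrite addnn odd_double.
by rewrite notin_cut addbF; case: (col _); case: (col _).
Qed.

(** The degree identity says that an edge joining the two ends would close the path into a 2-regular
    graph; in additive form it also covers a one-vertex path. *)
Lemma path_edges S x p : path (adjacent S) x p -> uniq (x :: p) ->
  exists Q, [/\ Q \subset S,
    forall v, (degree Q v + (v == x) + (v == last x p) = 2 * (v \in x :: p))%N &
    forall z, z \in x :: p -> connect (adjacent Q) x z].
Proof.
elim: p x => [x _ _|y p IHp x /= /andP[/exists_inP[e eS exy] yp] /andP[xp uyp]].
  exists set0; split; first exact: sub0set.
    by move=> v; rewrite /degree big_set0 !inE; case: (v == x).
  by move=> z; rewrite inE => /eqP->.
have [Q [QS degQ conQ]] := IHp y yp uyp.
have degx : degree Q x = 0%N.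
  by have /eqP := degQ x; rewrite (negPf xp) muln0 !addn_eq0 => /andP[/andP[/eqP]].
have endsE v : (((ends e).1 == v) + ((ends e).2 == v) = (v == x) + (v == y))%N.
  by case/orP: exy => /eqP-> /=; rewrite ![_ == v]eq_sym // addnC.
have eQ : e \notin Q.
  apply/negP => eQ; move/eqP: degx; rewrite /degree (big_setD1 e eQ) /= endsE eqxx.
  by rewrite !addn_eq0.
exists (e |: Q); split.
- by rewrite subUset sub1set eS.
- move=> v; rewrite degree_setU1 // endsE in_cons.
  have := degQ v; have [->|] := eqVneq v x.
    by rewrite degx (negPf xp) muln0 => /eqP; rewrite !addn_eq0 => /andP[/eqP-> /eqP->].
  by move=> _ /= <-; rewrite add0n addn0 [(_ + degree _ _)%N]addnC.
- have sub : subrel (adjacent Q) (connect (adjacent (e |: Q))).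
    move=> a b /exists_inP[f fQ fab]; apply: connect1; apply/exists_inP.
    by exists f => //; rewrite !inE fQ orbT.
  move=> z; rewrite in_cons => /orP[/eqP->//|/conQ yz].
  apply: connect_trans (connect_sub sub yz); apply: connect1; apply/exists_inP.
  by exists e; rewrite ?setU11.
Qed.

(** [e] closes a simple path of [T :\ e] between its ends, a trivial one if [e] is a loop. *)
Lemma exists_cycle T e : e \in T -> connected (T :\ e) ->
  exists2 C : {set edge G}, C \subset T & is_cycle C.
Proof.
move=> eT /forallP/(_ (ends e).2)/forallP/(_ (ends e).1)/connectP[p0 p0P].
case/shortenP: p0P => p pP up _ last_p.
have [Q [QT degQ conQ]] := path_edges pP up.
have eQ : e \notin Q by apply/negP => /(subsetP QT); rewrite !inE eqxx.
have degC v : degree (e |: Q) v = (2 * (v \in (ends e).2 :: p))%N.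
  rewrite degree_setU1 // -degQ -last_p -[RHS]addnA [LHS]addnC.
  by rewrite (eq_sym v (ends e).1) (eq_sym v (ends e).2) [X in _ = (_ + X)%N]addnC.

exists (e |: Q).
  by rewrite subUset sub1set eT (subset_trans QT) ?subD1set.
have sub : subrel (adjacent Q) (connect (adjacent (e |: Q))).
  move=> a b /exists_inP[f fQ fab]; apply: connect1; apply/exists_inP.
  by exists f => //; rewrite !inE fQ orbT.
apply/and3P; split.
- by apply/set0Pn; exists e; rewrite setU11.
- by apply/forallP => v; rewrite degC !inE -in_cons; case: (v \in _).
- apply/forallP => x; apply/forallP => y; rewrite !degC.
  have con z : z \in (ends e).2 :: p -> connect (adjacent (e |: Q)) (ends e).2 z.
    by move=> /conQ; apply: connect_sub.
  case: (boolP (x \in _)) => // /con cx; case: (boolP (y \in _)) => // /con cy /=.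
  by apply: connect_trans cy; rewrite connect_adjacent_sym.
Qed.

(** An acyclic connected set is minimally connected; conversely, removing an edge of a cycle would
    leave too few edges to connect. *)
Lemma spanning_treeE T : (0 < nvertices G)%N ->
  spanning_tree T = connected T && (#|T|.+1 == nvertices G).
Proof.
move=> n0; rewrite /spanning_tree; case: (boolP (connected T)) => //= conT.
apply/forallP/eqP => [acyc|cardT C].
  apply/eqP; rewrite eqn_leq nvertices_le_connected // andbT.
  apply: minimally_connected_le_nvertices => // e eT; apply/negP => con.
  have [C CT cyc] := exists_cycle eT con.
  by have := acyc C; rewrite CT cyc.
apply/implyP => CT; apply/negP => cyc.
have /set0Pn[e eC] : C != set0 by case/andP: cyc.
have := nvertices_le_connected (connected_rem_cycle cyc CT eC conT).
by rewrite -cardT [in X in (X <= _)%N](cardsD1 e) (subsetP CT) // ltnn.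
Qed.

End SpanningTrees.

(** * Real polynomials on the half-line *)

Section PolyLemmas.
Variable R : realType.
Implicit Types (p q d : {poly R}) (x y : R).

Lemma coef0_ge0 d : (forall y, 0 < y -> 0 <= d.[y]) -> 0 <= d`_0.
Proof.
elim/poly_ind: d => [|d c _] d0; first by rewrite coef0.
rewrite coefD coefMX coefC eqxx add0r leNgt; apply/negP => c0.
(* [B] bounds [d] on the unit interval; the factor 2 in [y] then makes [d.[y] * y + c] strictly
   negative. *)
pose B := 1 + \sum_(i < size d) `|d`_i|.
have B1 : 1 <= B by rewrite lerDl sumr_ge0.
pose y := Num.min 1 (- c / (B *+ 2)).
have B20 : 0 < B *+ 2 by rewrite mulrn_wgt0 // (lt_le_trans ltr01).
have y0 : 0 < y by rewrite lt_min ltr01 divr_gt0 // oppr_gt0.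
have y1 : y <= 1 by rewrite ge_min lexx.
have dB : d.[y] <= B.
  rewrite horner_coef /B; apply: ler_wpDl => //; apply: ler_sum => i _.
  apply: le_trans (ler_norm _) _; rewrite normrM normrX (ger0_norm (ltW y0)).
  by rewrite ler_piMr // exprn_ile1 // ltW.
have := d0 y y0; rewrite hornerD hornerMX hornerC; apply/negP; rewrite -ltNge.
have : y * (B *+ 2) <= - c by rewrite -ler_pdivlMr // ge_min lexx orbT.
have : d.[y] * y <= B * y by rewrite ler_pM2r.
have : 0 < y * B by rewrite mulr_gt0 // (lt_le_trans ltr01).
by rewrite mulrnAr [B * y]mulrC; move: (d.[y] * y) (y * B) => u v; lra.
Qed.

(** Dividing the difference by [y ^ j] turns this coefficient into a constant term. *)
Lemma coef_le_of_horner_le p q j :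
  (forall y, 0 < y -> p.[y] <= q.[y]) -> (forall i, (i < j)%N -> p`_i = q`_i) ->
  p`_j <= q`_j.
Proof.
move=> pq eqc; rewrite -subr_ge0 -coefB.
have E : drop_poly j (q - p) * 'X^j = q - p.
  rewrite -[RHS](poly_take_drop j) [take_poly _ _](_ : _ = 0) ?add0r //.
  apply/polyP => i; rewrite coef_take_poly coef0 coefB.
  by case: ltnP => // /eqc->; rewrite subrr.
rewrite -[j]add0n -coef_drop_poly; apply: coef0_ge0 => y y0.
have := pq y y0; rewrite -subr_ge0 -hornerN -hornerD -{1}E hornerM hornerXn.
by rewrite pmulr_lge0 ?exprn_gt0.
Qed.

Lemma coef_top_le_of_horner_le p q n : (size p <= n.+1)%N -> (size q <= n.+1)%N ->
  (forall y, 0 < y -> p.[y] <= q.[y]) -> p`_n <= q`_n.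
Proof.
move=> sp sq pq; rewrite -subr_ge0 -coefB.
have sd : (size (q - p)%R <= n.+1)%N.
  by apply: (leq_trans (size_polyD _ _)); rewrite size_polyN geq_max sq.
(* The reversed polynomial: inverting [y] makes the top coefficient the constant one. *)
pose e := \poly_(i < n.+1) (q - p)`_(n - i).
have <- : e`_0 = (q - p)`_n by rewrite coef_poly subn0.
apply: coef0_ge0 => y y0.
have -> : e.[y] = y ^+ n * (q - p).[y^-1].
  rewrite horner_poly (horner_coef_wide _ sd) mulr_sumr.
  rewrite (reindex_inj rev_ord_inj) /=; apply: eq_bigr => i _.
  have le_in : (i <= n)%N by rewrite -ltnS.
  rewrite subSS subKn // mulrCA; congr (_ * _).
  by rewrite exprVn -exprB ?unitfE ?gt_eqF.
rewrite pmulr_rge0 ?exprn_gt0 // hornerD hornerN subr_ge0.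
by apply: pq; rewrite invr_gt0.
Qed.

Lemma poly_eq_near_zero p q (eps : R) : 0 < eps ->
  (forall y, 0 <= y <= eps -> p.[y] = q.[y]) -> p = q.
Proof.
move=> eps0 pq; apply/eqP; rewrite -subr_eq0; apply/eqP.
pose s := [seq eps / (i.+1)%:R | i <- iota 0 (size (p - q)).+1].
apply: (@roots_geq_poly_eq0 _ _ s).
- apply/allP => _ /mapP[i _ ->]; rewrite rootE hornerD hornerN pq ?subrr //.
  rewrite divr_ge0 ?ler0n ?(ltW eps0) //= ler_pdivrMr ?ltr0n //.
  by rewrite ler_peMr ?ler1n // ltW.
- rewrite map_inj_uniq ?iota_uniq // => i j /(mulfI (lt0r_neq0 eps0)) /invr_inj.
  by move/eqP; rewrite eqr_nat => /eqP[].
- by rewrite size_map size_iota.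
Qed.

(** [(q + t) / q] tends to 1; Bernoulli's inequality makes this effective. *)
Lemma eventually_power_ratio_lt (a b : R) (t s : nat) : 0 <= a -> a < b ->
  exists q0 : nat, forall q : nat, (q0 <= q)%N ->
    (q + t)%:R ^+ s * a < q%:R ^+ s * b.
Proof.
move=> a0 ab.
have bernoulli (x : R) n : 0 <= x <= 1 -> 1 - n%:R * x <= (1 - x) ^+ n.
  move=> /andP[x0 x1]; elim: n => [|n IHn]; first by rewrite mul0r subr0 expr0.
  rewrite exprS; have := ler_wpM2l (_ : 0 <= 1 - x) IHn.
  rewrite subr_ge0 => /(_ x1); apply: le_trans; rewrite -natr1.
  have : 0 <= n%:R * x * x by rewrite !mulr_ge0.
  by move: (n%:R : R) => N; nra.
have b0 : 0 < b := le_lt_trans a0 ab.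
(* [C < q + t] is exactly [s x b < b - a] for [x = t / (q + t)]. *)
pose C := (s%:R * t%:R) * b / (b - a).
have C0 : 0 <= C by rewrite !mulr_ge0 // ?ltW // invr_gt0 subr_gt0.
exists (Num.truncn C).+1 => q leq.
have Cq : C < q%:R.
  by apply: lt_le_trans (truncnS_gt _) _; rewrite ler_nat.
have q0 : 0 < (q%:R : R) := le_lt_trans C0 Cq.
have qt0 : 0 < ((q + t)%:R : R) by rewrite natrD ltr_wpDr ?ler0n.
pose x : R := t%:R / (q + t)%:R.
have xE : 1 - x = q%:R / (q + t)%:R.
  have nz := lt0r_neq0 qt0.
  by apply: (mulIf nz); rewrite mulrBl mul1r !divfK // natrD addrK.
have x01 : 0 <= x <= 1.
  rewrite divr_ge0 //= ler_pdivrMr // mul1r ler_nat; exact: leq_addl.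
have := bernoulli x s x01; rewrite xE expr_div_n ler_pdivlMr ?exprn_gt0 // => H.
apply: lt_le_trans (_ : (1 - s%:R * x) * (q + t)%:R ^+ s * b <= _); last first.
  by rewrite ler_pM2r.
rewrite mulrAC mulrC ltr_pM2r ?exprn_gt0 //.
rewrite mulrBl mul1r ltrBrDr -ltrBrDl /x !mulrA mulrAC ltr_pdivrMr //.
rewrite -ltr_pdivrMl ?subr_gt0 // mulrC.
by apply: lt_le_trans Cq _; rewrite ler_nat leq_addr.
Qed.

End PolyLemmas.

(** * Reliability polynomials *)

Section ReliabilityPolynomial.
Variable R : comNzRingType.
Implicit Types (G D : multigraph).

Definition relpoly G : {poly R} := wsum (fun _ : edge G => 'X).

Lemma horner_wsum G (c : edge G -> {poly R}) y :
  (wsum c).[y] = wsum (fun e => (c e).[y]).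
Proof. by rewrite horner_sum; apply: eq_bigr => F _; rewrite horner_prod. Qed.

Lemma horner_relpoly G y : (relpoly G).[y] = wsum (fun _ : edge G => y).
Proof. by rewrite horner_wsum; apply: eq_wsum => e; rewrite hornerX. Qed.

Lemma coef_relpoly G j :
  (relpoly G)`_j = #|[set F : {set edge G} | connected (~: F) & #|F| == j]|%:R.
Proof.
rewrite /relpoly /wsum coef_sum -sum1_card natr_sum.
transitivity (\sum_(F : {set edge G} | connected (~: F) && (#|F| == j)) (1 : R)).
  2: by apply: eq_bigl => F; rewrite inE.
rewrite big_mkcondr; apply: eq_bigr => F _.
by rewrite prodr_const coefXn eq_sym; case: eqP.
Qed.

(** Complementation matches spanning trees with removable sets of [r] edges. *)
Lemma num_spanning_treesE G r : (0 < nvertices G)%N ->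
  (nedges G + 1 = nvertices G + r)%N ->
  (relpoly G)`_r = (num_spanning_trees G)%:R.
Proof.
move=> n0 red; rewrite coef_relpoly; congr _%:R.
rewrite -(card_imset _ (@setC_inj _)); apply: eq_card => T; rewrite inE spanning_treeE //.
have cardT : (#|T| + #|~: T| = nedges G)%N by rewrite cardsC.
have -> : (#|T|.+1 == nvertices G) = (#|~: T| == r).
  by move: cardT red; move: #|T| #|~: T| (nedges G) (nvertices G) => a b c d; lia.
apply/imsetP/andP => [[F + ->]|[conT rT]].
  by rewrite inE setCK => /andP[].
by exists (~: T); rewrite ?inE setCK // conT.
Qed.

Lemma size_relpoly G r : (nedges G + 1 = nvertices G + r)%N ->
  (size (relpoly G) <= r.+1)%N.
Proof.
move=> red; apply/leq_sizeP => j ltj; rewrite coef_relpoly eq_card0 // => F.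
rewrite inE; apply/andP => -[/nvertices_le_connected con /eqP Fj].
have := cardsC F; rewrite -[#|edge G|]/(nedges G) => E; lia.
Qed.

Lemma coef0_relpoly G : (relpoly G)`_0 = (connected [set: edge G])%:R.
Proof.
rewrite coef_relpoly; have [con|ncon] := boolP (connected _).
  rewrite (_ : [set _ | _ & _] = [set set0]) ?cards1 //; apply/setP => F.
  rewrite !inE cards_eq0; case: eqVneq => [->|_]; last by rewrite andbF.
  by rewrite setC0 con.
rewrite eq_card0 // => F; rewrite inE cards_eq0; apply/andP => -[conF /eqP F0].
by move: ncon; rewrite -setC0 -F0 conF.
Qed.

(** The last identity is Newton's 2 e_2 + p_2 = e_1^2, kept free of division over a general ring. *)
Lemma coef_prod_linear (I : Type) (s : seq I) (c : I -> nat) :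
  let p := \prod_(i <- s) ('X *+ c i + 1) : {poly R} in
  [/\ p`_0 = 1, p`_1 = (\sum_(i <- s) c i)%:R &
      p`_2 *+ 2 + (\sum_(i <- s) c i ^ 2)%:R = ((\sum_(i <- s) c i) ^ 2)%:R].
Proof.
elim: s => [|i s [p0 p1 p2]] /=; first by rewrite !big_nil !coef1 /= mul0rn add0r.
rewrite !big_cons; set p := \prod_(j <- s) _ in p0 p1 p2 *.
have coefE j : (('X *+ c i + 1) * p)`_j = (if j == 0%N then 0 else p`_j.-1) *+ c i + p`_j.
  by rewrite mulrDl mul1r mulrnAl coefD coefMn coefXM.
rewrite !coefE /= p0 p1 mul0rn add0r; split=> //; first by rewrite natrD.
rewrite mulrnDl natrD addrACA p2 -!mulrnA -!natrD; congr _%:R.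
by rewrite sqrnD; lia.
Qed.

(** All sets of at most two edges are removable, so up to degree 2 the sum agrees with the product
    of all ['X *+ c e + 1]. *)
Lemma coef_weighted_relpoly D (c : edge D -> nat) : three_edge_connected D ->
  let p := wsum (fun e => 'X *+ c e) : {poly R} in
  [/\ p`_0 = 1, p`_1 = (\sum_e c e)%:R &
      p`_2 *+ 2 + (\sum_e c e ^ 2)%:R = ((\sum_e c e) ^ 2)%:R].
Proof.
move=> tec p.
have pE j : (j <= 2)%N -> p`_j = (\prod_e ('X *+ c e + 1) : {poly R})`_j.
  move=> j2; rewrite bigA_distr (bigID (fun F : {set _} => connected (~: F))) /=.
  rewrite coefD [X in _ = _ + X]coef_sum [X in _ = _ + X]big1 ?addr0 => [|F ncon].
    by under [in RHS]eq_bigr do rewrite -big_mkcond.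
  rewrite -big_mkcond; under eq_bigr do rewrite -scaler_nat.
  rewrite scaler_prod prodr_const coefZ coefXn (_ : j == _ = false) ?mulr0 //.
  by apply: contraNF ncon => /eqP jF; apply: tec; rewrite -jF.
rewrite !pE //; exact: coef_prod_linear.
Qed.

End ReliabilityPolynomial.

(** * Unreliability in terms of the odds of failure *)

Section Unreliability.
Variable R : realType.

Lemma unreliabilityE G (p : R) : p != 1 ->
  unreliability G p =
    1 - (1 - p) ^+ nedges G * wsum (fun _ : edge G => p / (1 - p)).
Proof.
move=> p1; apply/eqP; rewrite eq_sym subr_eq; apply/eqP.
transitivity (\prod_(e : edge G) (p + (1 - p))).
  by rewrite big1 // => e _; rewrite addrC subrK.
rewrite bigA_distr (bigID (fun F : {set _} => ~~ connected (~: F))) /=; congr (_ + _).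
rewrite mulr_sumr; apply: eq_big => [F|F _]; first by rewrite negbK.
have nz : 1 - p != 0 by rewrite subr_eq0 eq_sym.
rewrite -[(1 - p) ^+ _]/((1 - p) ^+ #|edge G|) -prodr_const.
rewrite [X in _ = _ * X]big_mkcond -big_split; apply: eq_bigr => e _ /=.
by case: ifP => _; rewrite ?mulr1 // mulrC divfK.
Qed.

(** The substitution inverts [y = p / (1 - p)], and the power of [1 - p] is common to both
    graphs. *)
Lemma unreliability_le G H (y : R) : 0 <= y -> nedges G = nedges H ->
  (unreliability G (y / (1 + y)) <= unreliability H (y / (1 + y))) =
  (wsum (fun _ : edge H => y) <= wsum (fun _ : edge G => y)).
Proof.
move=> y0 E; have y1 : 0 < 1 + y by rewrite ltr_wpDr.
have qE : 1 - y / (1 + y) = (1 + y)^-1.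
  apply: (mulIf (lt0r_neq0 y1)); rewrite mulrBl mul1r divfK ?lt0r_neq0 //.
  by rewrite mulVf ?lt0r_neq0 // addrK.
have p1 : y / (1 + y) != 1.
  by rewrite -subr_eq0 -oppr_eq0 opprB qE invr_eq0 lt0r_neq0.
rewrite !unreliabilityE // qE invrK divfK ?lt0r_neq0 // E.
by rewrite lerD2l lerN2 ler_pM2l // exprn_gt0 // invr_gt0.
Qed.

End Unreliability.

(** * Degree counts *)

Lemma double_nedges (G : multigraph) :
  (\sum_v degree [set: edge G] v = 2 * nedges G)%N.
Proof.
by rewrite (sum_degree _ xpredT) (eq_bigr (fun=> 2%N)) // sum_nat_const cardsT mulnC.
Qed.

Lemma cubic_nedges (G : multigraph) : cubic G -> (2 * nedges G = 3 * nvertices G)%N.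
Proof.
move=> /forallP cub; rewrite -double_nedges (eq_bigr (fun=> 3%N)) => [|v _].
  by rewrite sum_nat_const mulnC.
exact/eqP.
Qed.

Lemma three_edge_connected_degree (G : multigraph) (v : vertex G) :
  three_edge_connected G -> (1 < nvertices G)%N -> (3 <= degree [set: edge G] v)%N.
Proof.
move=> /three_edge_connectedP tec /card_gt1P[x [y [_ _ xy]]].
have cut3 : (2 < #|cut (pred1 v)|)%N.
  rewrite ltnNge; apply/negP => /tec const.
  have xv : x = v by apply/eqP; rewrite -[_ == _]/(pred1 v x) (const x v) /= eqxx.
  have yv : y = v by apply/eqP; rewrite -[_ == _]/(pred1 v y) (const y v) /= eqxx.
  by rewrite xv yv eqxx in xy.
apply: leq_trans cut3 _; rewrite -sum1_card /degree big_mkcond.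
rewrite [leqRHS]big_mkcond; apply: leq_sum => e _; rewrite !inE /=.
by case: (_ == v); case: (_ == v).
Qed.

(** By handshaking, 3n <= 2m; with m = n + r - 1 this bounds m, and equality forces every degree to
    be 3. With at most one vertex, m <= r < 3(r - 1). *)
Lemma three_edge_connected_sparse (G : multigraph) r : (1 < r)%N ->
  (nedges G + 1 = nvertices G + r)%N -> three_edge_connected G ->
  (nedges G <= 3 * (r - 1))%N /\
  (nedges G = (3 * (r - 1))%N -> cubic G /\ nvertices G = (2 * (r - 1))%N).
Proof.
move=> r1 red tec; have [n1|n1] := ltnP 1 (nvertices G); last by split; lia.
have deg3 v := three_edge_connected_degree v tec n1.
have deg_sum : (\sum_(v : vertex G) 3 <= \sum_v degree [set: edge G] v)%N.
  by apply: leq_sum => v _; apply: deg3.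
have [] := (deg_sum, double_nedges G); rewrite sum_nat_const -/(nvertices G).
move=> deg_sum' E; rewrite E in deg_sum'.
split; first lia.
move=> s; split; last lia.
apply/forallP => v; rewrite eq_sym.
have : (\sum_(v : vertex G) 3 == \sum_v degree [set: edge G] v)%N.
  by rewrite E sum_nat_const -/(nvertices G); apply/eqP; lia.
rewrite (leqif_sum (fun v _ => leqif_eq (deg3 v))) => /forall_inP; exact.
Qed.

(** * Balanced weights and finiteness *)

Lemma exists_balanced_weights (E : finType) m : (0 < #|E|)%N ->
  exists b : E -> nat, (\sum_e b e = m)%N /\
    forall e, (m %/ #|E| <= b e <= (m %/ #|E|).+1)%N.
Proof.
(* The remainder is spread, one unit each, over the first elements of the enumeration. *)
move=> E0; exists (fun e => (m %/ #|E| + (enum_rank e < m %% #|E|))%N); split; last first.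
  by move=> e; rewrite leq_addr /=; case: (_ < _)%N; rewrite ?addn1 ?addn0.
rewrite big_split /= sum_nat_const mulnC [RHS](divn_eq m #|E|); congr (_ + _)%N.
rewrite (reindex (@enum_val _ E)) /=; last exact/onW_bij/enum_val_bij.
have ltm : (m %% #|E| <= #|E|)%N by rewrite ltnW ?ltn_mod.
transitivity (\sum_(i < #|E| | (i < m %% #|E|)%N) 1)%N.
  by rewrite [RHS]big_mkcond; apply: eq_bigr => i _; rewrite enum_valK; case: (_ < _)%N.
by rewrite -(big_ord_widen _ (fun=> 1%N) ltm) sum1_card card_ord.
Qed.

Section Weighted.
Variable R : realType.

Lemma wsum_le (G : multigraph) (c d : edge G -> R) :
  (forall e, 0 <= c e <= d e) -> wsum c <= wsum d.
Proof. by move=> cd; apply: ler_sum => F _; apply: ler_prod => e _. Qed.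

Lemma wsum_scale_le (G : multigraph) (k y : R) : 1 <= k -> 0 <= y ->
  wsum (fun _ : edge G => k * y) <= k ^+ nedges G * wsum (fun _ : edge G => y).
Proof.
move=> k1 y0; rewrite mulr_sumr; apply: ler_sum => F _.
rewrite !prodr_const exprMn ler_wpM2r ?exprn_ge0 // ler_weXn2l //.
exact: max_card.
Qed.

Lemma sum_sqr_dev (I : finType) (f : I -> nat) (q : nat) :
  \sum_i ((f i)%:R - q%:R) ^+ 2 =
  (\sum_i f i ^ 2)%:R - (q * (\sum_i f i))%:R *+ 2 + (#|I| * q ^ 2)%:R :> int.
Proof.
under [LHS]eq_bigr do rewrite sqrrB.
rewrite !big_split /= sumr_const (natrM _ q) (natrM _ #|I|) natrX.
rewrite [#|I|%:R * _]mulr_natl; congr (_ + _).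
rewrite !natr_sum sumrN mulr_sumr -sumrMnl; congr (_ - _).
  by apply: eq_bigr => i _; rewrite natrX.
by apply: eq_bigr => i _; rewrite mulrC.
Qed.

(* Expanding [(k - q) ^ 2] with the common total, [d] deviates from [q], absent
   edges counting as weight 0, at most as much as [b] does, hence by at most
   [#|E1|] in square. *)
Lemma weights_nearly_constant (E1 E2 : finType) (b : E1 -> nat) (d : E2 -> nat) q :
  (forall e, q <= b e <= q.+1)%N -> (#|E2| <= #|E1|)%N -> (#|E1| < q)%N ->
  (\sum_e d e = \sum_e b e)%N -> (\sum_e d e ^ 2 <= \sum_e b e ^ 2)%N ->
  #|E2| = #|E1| /\ forall e, (d e <= q + #|E1|)%N.
Proof.
move=> bq le21 ltq sum1 sum2.
have dev : \sum_e ((d e)%:R - q%:R) ^+ 2 + ((#|E1| - #|E2|) * q ^ 2)%:R <= #|E1|%:R :> int.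
  apply: (@le_trans _ _ (\sum_e ((b e)%:R - q%:R) ^+ 2)).
    rewrite !sum_sqr_dev sum1 -addrA -natrD -mulnDl subnKC // !lerD2r.
    by rewrite ler_nat.
  rewrite -sum1_card natr_sum; apply: ler_sum => e _.
  by have /andP[] := bq e; move: (b e) => k; nia.
have dev0 (P : pred E2) : 0 <= \sum_(e | P e) ((d e)%:R - q%:R) ^+ 2 :> int.
  by apply: sumr_ge0 => e _; apply: sqr_ge0.
split.
  apply/eqP; rewrite eqn_leq le21 leqNgt; apply/negP => lt21.
  have := dev0 predT; move: dev; move: (\sum_(e | _) _) => S.
  have : (1 * q ^ 2 <= (#|E1| - #|E2|) * q ^ 2)%N by rewrite leq_mul2r subn_gt0 lt21 orbT.
  by nia.
move=> e; rewrite leqNgt; apply/negP => lte.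
move: dev; rewrite (bigD1 e) //=; have := dev0 (fun i => i != e).
have aux (N : nat) (S x z : int) :
    0 <= z -> N.+1%:R <= x -> 0 <= S -> x ^+ 2 + S + z <= N%:R -> False.
  by rewrite expr2; nia.
move=> S0 H; apply: (aux _ _ _ _ _ _ S0 H); first exact: ler0n.
by rewrite lerBrDr -natrD ler_nat addSn addnC.
Qed.

Lemma relpoly_finite_range (G : multigraph) s : nedges G = s ->
  exists a : {ffun 'I_s.+1 -> 'I_(2 ^ s).+1},
    relpoly R G = \poly_(j < s.+1) (a (inord j))%:R.
Proof.
move=> <-.
pose N (j : nat) := #|[set F : {set edge G} | connected (~: F) & #|F| == j]|.
have N2 j : (N j < (2 ^ nedges G).+1)%N.
  by rewrite ltnS /nedges -cardsT -card_powerset powersetT subset_leq_card ?subsetT.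
exists [ffun j : 'I__ => inord (N j)]; apply/polyP => j.
rewrite coef_poly; case: ltnP => [ltj|lej].
  by rewrite coef_relpoly ffunE inordK // inordK.
rewrite coef_relpoly eq_card0 // => F; rewrite inE; apply/andP => -[_ /eqP Fj].
by have := max_card F; rewrite Fj leqNgt lej.
Qed.

End Weighted.

(** * Uniformly most reliable graphs *)

Section Comparison.
Variable R : realType.

Lemma umr_wsum_le (G H : multigraph) (y : R) : uniformly_most_reliable R H ->
  nvertices G = nvertices H -> nedges G = nedges H -> 0 <= y ->
  wsum (fun _ : edge G => y) <= wsum (fun _ : edge H => y).
Proof.
move=> umr nv ne y0; rewrite -unreliability_le //; apply: umr => //.
have y1 : 0 < 1 + y by rewrite ltr_wpDr.
by rewrite divr_ge0 ?(ltW y1) //= ler_pdivrMr // mul1r lerDr.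
Qed.

Lemma most_reliable_cubic_wsum_le (G : multigraph) : most_reliable_cubic_near_zero R G ->
  exists2 eps : R, 0 < eps & forall (H : multigraph) (y : R), cubic H ->
    nvertices H = nvertices G -> 0 <= y <= eps ->
    wsum (fun _ : edge H => y) <= wsum (fun _ : edge G => y).
Proof.
move=> [cubG [eps eps0 best]]; exists eps => // H y cubH nv /andP[y0 yeps].
have ne : nedges G = nedges H.
  by have := cubic_nedges cubG; have := cubic_nedges cubH; rewrite nv; lia.
rewrite -unreliability_le //; apply: best => //.
have y1 : 0 < 1 + y by rewrite ltr_wpDr.
rewrite divr_ge0 ?(ltW y1) //= ler_pdivrMr // (le_trans yeps) //.
by rewrite ler_peMr ?(ltW eps0) // lerDl.
Qed.

(** The weights are realised by replacing each edge [e] of [X] with a path of [b e] edges; the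
    result has as many vertices and edges as [H]. *)
Lemma umr_dominates_weighted (H X : multigraph) (b : edge X -> nat) :
  uniformly_most_reliable R H -> (forall e, 0 < b e)%N ->
  (\sum_e b e = nedges H)%N ->
  (nedges X + nvertices H = nedges H + nvertices X)%N ->
  forall y : R, 0 <= y ->
  wsum (fun e => y *+ b e) <= wsum (fun _ : edge H => y).
Proof.
move=> umr b0 sumb red y y0; have [X' [E1 E2 W]] := exists_subdivision b0.
rewrite -W; apply: umr_wsum_le => //; last by rewrite E1.
by move: E2 red; rewrite E1 sumb; lia.
Qed.

(** Against a balanced subdivision of [M], the coefficients of degrees 0, 1 and 2 show in turn that
    [H] is connected, that its reduction [D] loses no weight, and that its weights are nearly
    constant. *)
Lemma umr_structure (H : multigraph) r : (1 < r)%N ->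
  (nedges H + 1 = nvertices H + r)%N -> uniformly_most_reliable R H ->
  let s := (3 * (r - 1))%N in let q := (nedges H %/ s)%N in (s < q)%N ->
  exists D (d : edge D -> nat),
    [/\ cubic D, nvertices D = (2 * (r - 1))%N, nedges D = s,
        (forall e, d e <= q + s)%N &
        forall y : R, wsum (fun _ : edge H => y) = wsum (fun e => y *+ d e)].
Proof.
move=> r1 red umr s q ltq; have r0 : (0 < r - 1)%N by rewrite subn_gt0.
have [M [Mv Me Mtec]] := exists_three_edge_connected r0.
have cardM : #|edge M| = s by [].
have s0 : (0 < s)%N by rewrite muln_gt0.
have E0 : (0 < #|edge M|)%N by rewrite cardM.
have [b [sumb bq]] := exists_balanced_weights (nedges H) E0.
rewrite cardM -/q in bq.
have b0 e : (0 < b e)%N by have /andP[h _] := bq e; apply: leq_trans h; apply: leq_ltn_trans ltq.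
have Mred : (nedges M + nvertices H = nedges H + nvertices M)%N.
  by rewrite Me Mv; move: red r1; clear; lia.
have domM := umr_dominates_weighted umr b0 sumb Mred.
have [pM0 pM1 pM2] := coef_weighted_relpoly R b Mtec.
set pM := wsum _ in pM0 pM1 pM2.
have hornerXn n (y : R) : ('X *+ n).[y] = y *+ n by rewrite hornerMn hornerX.
have pM_le (p : {poly R}) : (forall y, p.[y] = wsum (fun _ : edge H => y)) ->
    forall y, 0 < y -> pM.[y] <= p.[y].
  move=> pE y y0; rewrite pE horner_wsum.
  rewrite (eq_wsum (d := fun e => y *+ b e)) => [|e]; last exact: hornerXn.
  exact/domM/ltW.
have conH : connected [set: edge H].
  have : pM`_0 <= (relpoly R H)`_0.
    by apply: coef_le_of_horner_le => //; apply: pM_le => y; apply: horner_relpoly.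
  by rewrite pM0 coef0_relpoly; case: connected => //; rewrite ler10.
have [D [d [Dtec Dred d0 led W]]] :=
  reduce_to_three_edge_connected (c := fun=> 1%N) conH (fun=> isT).
have HD (y : R) : wsum (fun _ : edge H => y) = wsum (fun e => y *+ d e) by rewrite -W.
have [pD0 pD1 pD2] := coef_weighted_relpoly R d Dtec.
set pD := wsum _ in pD0 pD1 pD2.
have le_MD : forall y, 0 < y -> pM.[y] <= pD.[y].
  apply: pM_le => y; rewrite HD horner_wsum.
  by apply: eq_wsum => e; apply: hornerXn.
have sumd : (\sum_e d e = \sum_e b e)%N.
  apply/eqP; rewrite eqn_leq sumb; apply/andP; split.
    by apply: leq_trans led _; rewrite sum1_card.
  rewrite -sumb -(ler_nat R) -pM1 -pD1; apply: coef_le_of_horner_le => // -[|//] _.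
  by rewrite pM0 pD0.
(* For equal totals, a larger quadratic coefficient means a smaller sum of squares. *)
have sumd2 : (\sum_e d e ^ 2 <= \sum_e b e ^ 2)%N.
  have : pM`_2 <= pD`_2.
    apply: coef_le_of_horner_le => // -[_|[_|//]]; first by rewrite pM0 pD0.
    by rewrite pM1 pD1 sumd.
  have : pM`_2 *+ 2 + (\sum_e b e ^ 2)%:R = pD`_2 *+ 2 + (\sum_e d e ^ 2)%:R.
    by rewrite pM2 pD2 sumd.
  by rewrite -(ler_nat R); move: (pM`_2) (pD`_2) (_%:R) (_%:R) => u v w z; lra.
have Dred' : (nedges D + 1 = nvertices D + r)%N by move: Dred red; clear; lia.
have [sD cubD] := three_edge_connected_sparse r1 Dred' Dtec.
have leDM : (#|edge D| <= #|edge M|)%N by rewrite cardM.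
have ltMq : (#|edge M| < q)%N by rewrite cardM.
have [DM dq] := weights_nearly_constant bq leDM ltMq sumd sumd2.
have DE : nedges D = s by rewrite [nedges D]DM.
have [cubicD Dv] := cubD DE.
exists D, d; split=> //.
by move=> e; rewrite -cardM.
Qed.

(** At [y = z / q], balanced weights turn each edge variable of [X] into at least [z], while those
    of [D] are at most [k z] with [k = (q + s) / q]; the factor [k] costs at most [k ^ s]. *)
Lemma umr_dominates (H : multigraph) r : (1 < r)%N ->
  (nedges H + 1 = nvertices H + r)%N -> uniformly_most_reliable R H ->
  let s := (3 * (r - 1))%N in let q := (nedges H %/ s)%N in (s < q)%N ->
  exists D, [/\ cubic D, nvertices D = (2 * (r - 1))%N, nedges D = s &
    forall (X : multigraph) (z : R), nvertices X = nvertices D -> nedges X = s -> 0 <= z ->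
      q%:R ^+ s * wsum (fun _ : edge X => z) <= (q + s)%:R ^+ s * wsum (fun _ : edge D => z)].
Proof.
move=> r1 red umr s q ltq.
have [D [d [cubD Dv De dq W]]] := umr_structure r1 red umr ltq.
exists D; split=> // X z Xv Xe z0.
have q0 : (0 < q)%N by apply: leq_ltn_trans ltq.
have q0R : 0 < (q%:R : R) by rewrite ltr0n.
have r0 : (0 < r - 1)%N by rewrite subn_gt0.
have E0 : (0 < #|edge X|)%N by rewrite [#|_|]Xe muln_gt0.
have [b [sumb bq]] := exists_balanced_weights (nedges H) E0.
rewrite [#|_|]Xe -/q in bq.
have b0 e : (0 < b e)%N by have /andP[h _] := bq e; apply: leq_trans h.
have Xred : (nedges X + nvertices H = nedges H + nvertices X)%N.
  by rewrite Xe Xv Dv; move: red r1; clear; lia.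
pose y := z / q%:R; have y0 : 0 <= y by rewrite divr_ge0 // ltW.
have yq : y *+ q = z by rewrite -[LHS]mulr_natr divfK // lt0r_neq0.
have kE : (q + s)%:R / q%:R * z = y *+ (q + s).
  by rewrite -[RHS]mulr_natr /y [LHS]mulrC [LHS]mulrA mulrAC.
rewrite -ler_pdivlMl ?exprn_gt0 // mulrA [_^-1 * _]mulrC -expr_div_n.
have k1 : 1 <= (q + s)%:R / q%:R :> R by rewrite ler_pdivlMr // mul1r ler_nat leq_addr.
have := wsum_scale_le D k1 z0; rewrite De; apply: le_trans.
apply: (@le_trans _ _ (wsum (fun e => y *+ b e))).
  apply: wsum_le => e; rewrite z0 -yq /= ler_wpMn2l //.
  by have /andP[] := bq e.
apply: le_trans (umr_dominates_weighted umr b0 sumb Xred y0) _.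
rewrite W; apply: wsum_le => e; rewrite mulrn_wge0 //= kE.
exact: ler_wpMn2l.
Qed.

End Comparison.

(* Some test point [z] separates [Q] from [relpoly G] or [relpoly K]: otherwise
   [Q] would agree with [relpoly G] near zero, hence everywhere, and
   [relpoly G] would dominate [relpoly K] up to the leading coefficients, which
   count spanning trees. *)
Lemma exists_separating_point (R : realType) r (G K : multigraph) (Q : {poly R}) (eps : R) :
  (0 < nvertices G)%N -> (nedges G + 1 = nvertices G + r)%N ->
  nvertices K = nvertices G -> nedges K = nedges G ->
  (num_spanning_trees G < num_spanning_trees K)%N ->
  0 < eps -> (forall z, 0 <= z <= eps -> Q.[z] <= (relpoly R G).[z]) ->
  exists2 z, 0 <= z & Q.[z] < Num.max (relpoly R G).[z] (relpoly R K).[z].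
Proof.
move=> n0 red Kv Ke lt_trees eps0 QG; apply: contrapT => nz.
have QGK z : 0 <= z -> (relpoly R G).[z] <= Q.[z] /\ (relpoly R K).[z] <= Q.[z].
  move=> z0; apply/andP; rewrite -ge_max leNgt; apply/negP => lt.
  by apply: nz; exists z.
have QE : Q = relpoly R G.
  apply: (poly_eq_near_zero eps0) => z zeps; apply/eqP; rewrite eq_le QG //=.
  by have /andP[z0 _] := zeps; have [] := QGK z z0.
have Kred : (nedges K + 1 = nvertices K + r)%N by rewrite Kv Ke.
have : (relpoly R K)`_r <= (relpoly R G)`_r.
  apply: coef_top_le_of_horner_le; [exact: size_relpoly|exact: size_relpoly|].
  by move=> z z0; rewrite -QE; have [] := QGK z (ltW z0).
have K0 : (0 < nvertices K)%N by rewrite Kv.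
by rewrite (num_spanning_treesE _ n0 red) (num_spanning_treesE _ K0 Kred)
  ler_nat leqNgt lt_trees.
Qed.

Theorem lemma4p8 (R : realType) (r : nat) (hr : (1 < r)%N)
    (G : multigraph) (hGn : nvertices G = (2 * (r - 1))%N)
    (hG : most_reliable_cubic_near_zero R G)
    (hGt : ~ maximizes_spanning_trees G) :
  exists n0 : nat, forall n : nat, (n0 < n)%N ->
    ~ exists H : multigraph,
        [/\ nvertices H = n, redundancy H = r%:Z & uniformly_most_reliable R H].
Proof.
have [K [Kv Ke lt_trees]] : exists K, [/\ nvertices K = nvertices G,
    nedges K = nedges G & (num_spanning_trees G < num_spanning_trees K)%N].
  apply: contrapT => noK; apply: hGt => K Kv Ke; rewrite leqNgt; apply/negP => lt.
  by apply: noK; exists K.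
have [eps eps0 bestG] := most_reliable_cubic_wsum_le hG.
pose s := (3 * (r - 1))%N.
have s0 : (0 < s)%N by rewrite muln_gt0 subn_gt0.
have Ge : nedges G = s.
  by have := cubic_nedges (proj1 hG); rewrite hGn /s; lia.
have n0 : (0 < nvertices G)%N by rewrite hGn muln_gt0 subn_gt0.
have Gred : (nedges G + 1 = nvertices G + r)%N.
  by rewrite Ge hGn /s; move: hr; clear; lia.
(* [P] covers every polynomial that a graph with [s] edges can have. *)
pose P (a : {ffun 'I_s.+1 -> 'I_(2 ^ s).+1}) : {poly R} :=
  \poly_(j < s.+1) (a (inord j))%:R.
(* The constraints on the polynomial of [D] if [H] exists; each candidate violates them for all
   large [q]. *)
pose bad (Q : {poly R}) q :=
  (forall z, 0 <= z <= eps -> Q.[z] <= (relpoly R G).[z]) /\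
  (forall z, 0 <= z -> q%:R ^+ s * Num.max (relpoly R G).[z] (relpoly R K).[z] <=
     (q + s)%:R ^+ s * Q.[z]).
have /fin_all_exists[q0 q0P] (a : {ffun 'I_s.+1 -> 'I_(2 ^ s).+1}) :
    exists q0 : nat, forall q, (q0 <= q)%N -> ~ bad (P a) q.
  have [QG|nQG] := pselect (forall z, 0 <= z <= eps -> (P a).[z] <= (relpoly R G).[z]).
    have [z z0 ltz] := exists_separating_point n0 Gred Kv Ke lt_trees eps0 QG.
    have Pz0 : 0 <= (P a).[z].
      by rewrite horner_poly sumr_ge0 // => j _; rewrite mulr_ge0 ?exprn_ge0.
    have [q0 q0P] := eventually_power_ratio_lt s s Pz0 ltz.
    exists q0 => q /q0P ltq [_ /(_ z z0)]; by rewrite leNgt ltq.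
  by exists 0%N => q _ [].
(* Since [H] has more than [n] edges, this makes the quotient [q] exceed [s] and every [q0 a]. *)
exists (s * (\max_a q0 a + s).+1)%N => n ltn [H [Hv Hr umr]].
have Hred : (nedges H + 1 = nvertices H + r)%N.
  by move: Hr; rewrite /redundancy; lia.
set q := (nedges H %/ s)%N.
have ltq : (\max_a q0 a + s < q)%N.
  rewrite leq_divRL // mulnC; move: ltn Hred; rewrite Hv; move: hr; clear; lia.
have [D [cubD Dv De dom]] :=
  umr_dominates hr Hred umr (leq_ltn_trans (leq_addl _ _) ltq).
have [a DE] := relpoly_finite_range R De.
apply: (q0P a q).
  apply: leq_trans (ltnW ltq); apply: leq_trans (leq_addr _ _).
  exact: leq_bigmax.
rewrite /bad /P -DE; split=> [z zeps|z z0].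
  by rewrite !horner_relpoly; apply: bestG => //; rewrite Dv.
rewrite maxr_pMr ?exprn_ge0 // ge_max !horner_relpoly.
by rewrite !dom // ?Kv ?Ke ?Ge ?Dv.
Qed.
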